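(* Let $P$ be a partial algorithm from natural numbers to $\{0,1\}$ that is not extendable to a totally defined algorithm, and for each natural number $n$ let $a_n^1$ and $a_n^2$ be the constructive real numbers built from $P$ as in the context. Let $AM=\frac{a_n^1+a_n^2}{2}$ and $GM=\sqrt{a_n^1a_n^2}$. Then it is undecidable whether $AM=GM$ or $AM>GM$; that is, there is no algorithm which, for every natural number $n$, terminates and correctly decides which of $\frac{a_n^1+a_n^2}{2}=\sqrt{a_n^1a_n^2}$ or $\frac{a_n^1+a_n^2}{2}>\sqrt{a_n^1a_n^2}$ holds.
   Context: ''Algorithm'' means a (partial) computable function on natural numbers given by a program; ''totally defined'' means that it terminates on every input. $P$ is a partially defined algorithm taking values in $\{0,1\}$ such that no total computable function $\mathbb{N}\to\{0,1\}$ agrees with $P$ on the whole domain of $P$. A program computing $P$ is fixed, so that one can check effectively whether $P$ has finished working on input $n$ by step $k$; if $P$ terminates on $n$, it finishes at a definite step. A constructive real number (CRN) is a pair of algorithms $(A,B)$, where $A$ transforms natural numbers into rational numbers and $B$ transforms natural numbers into natural numbers, such that for every integer $n>0$ and all $i,j\ge B(n)$ one has $|A(i)-A(j)|<2^{-n}$. If the CRN is denoted $x$, then $x(k)$ denotes $A(k)$; its value is the real number $\lim_k x(k)$, and equalities and inequalities between CRNs, and between expressions in them, refer to these values. Construction: for each natural $n$, $a_n^1$ is the CRN whose sequence of rationals is $a_n^1(k)=3+2^{-k}$ if $P$ has not yet finished working on input $n$ by step $k$, and $a_n^1(k)=3+2^{-m}$ if $P$ has finished working on $n$ by step $k$, where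 $m$ is the step number at which $P$ finished working. (This sequence converges in itself at geometric speed, so it gives a CRN.) The CRN $a_n^2$ is the constant sequence $3$ for every $n$. *)

(* Defs.v *)
From HB Require Import structures.
From mathcomp Require Import all_boot all_order all_algebra.
From mathcomp Require Import zify ring lra.
From mathcomp Require Import boolp classical_sets reals topology normedtype.
From mathcomp Require Import sequences.

Set Implicit Arguments.
Unset Strict Implicit.
Unset Printing Implicit Defensive.
Import Order.TTheory GRing.Theory Num.Theory.
Import numFieldNormedType.Exports.

(** Algorithms are programs for a counter machine with structured loops: there
    are countably many registers holding natural numbers, [Dec] is truncated at
    [0], and [While r b] repeats [b] as long as register [r] is nonzero. These
    programs compute exactly the partial recursive functions. *)
Inductive cmd := Inc of nat | Dec of nat | While of nat & seq cmd.
Definition program := seq cmd.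
Definition store := nat -> nat.
Definition upd (s : store) r v : store := fun x => if x == r then v else s x.

(** A configuration is the list of commands still to be executed together with
    the current store; one step executes an increment, a decrement or a loop
    test. The machine has finished when no command is left. *)
Definition config := (program * store)%type.

Definition step (c : config) : config :=
  let: (p, s) := c in
  match p with
  | [::] => c
  | Inc r :: q => (q, upd s r (s r).+1)
  | Dec r :: q => (q, upd s r (s r).-1)
  | While r b :: q => if s r == 0 then (q, s) else (b ++ p, s)
  end.

Definition init (n : nat) : store := upd (fun _ => 0) 0 n.
Definition run (p : program) (n k : nat) : config := iter k step (p, init n).

(** [p] has finished working on input [n] by step [k] *)
Definition finished (p : program) (n k : nat) : bool := nilp (run p n k).1.

(** A natural number is output in register [0]. *)
Definition computes (p : program) (n y : nat) : Prop :=
  exists k, finished p n k /\ (run p n k).2 0 = y.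

(** A rational number is output as [(r0 - r1) / (r2 + 1)], where [r0], [r1] and
    [r2] are the final contents of the first three registers. *)
Definition rat_of_store (s : store) : rat :=
  (((s 0)%:R - (s 1)%:R) / (s 2).+1%:R)%R.

Definition computes_rat (p : program) (n : nat) (q : rat) : Prop :=
  exists k, finished p n k /\ rat_of_store (run p n k).2 = q.

Definition binary_valued (p : program) : Prop :=
  forall n y, computes p n y -> y = 0 \/ y = 1.

Definition extendable (p : program) : Prop :=
  exists q : program,
    (forall n, exists b : bool, computes q n b) /\
    (forall n y, computes p n y -> computes q n y).

Local Open Scope ring_scope.

(** A constructive real number is given by the programs [crn_A] and [crn_B];
    [crn_seq] and [crn_mod] are the total functions that they compute. *)
Record crn := Crn {
  crn_A : program;
  crn_B : program;
  crn_seq :> nat -> rat;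
  crn_mod : nat -> nat;
  crn_AP : forall k, computes_rat crn_A k (crn_seq k);
  crn_BP : forall n, computes crn_B n (crn_mod n);
  crn_cauchy : forall n i j : nat, (0 < n)%N ->
    (crn_mod n <= i)%N -> (crn_mod n <= j)%N ->
    `|crn_seq i - crn_seq j| < 2 ^- n }.

Local Open Scope classical_set_scope.
Definition crn_val (R : realType) (x : crn) : R :=
  lim ((ratr (x k) : R) @[k --> \oo]).

Local Close Scope classical_set_scope.

(** The first step at which [p] has finished working on [n], provided that it
    has finished by step [k]. *)
Definition finish_step (p : program) (n k : nat) : nat :=
  find (finished p n) (iota 0 k.+1).

Definition a1_seq (P : program) (n k : nat) : rat :=
  if finished P n k then 3 + 2 ^- finish_step P n k else 3 + 2 ^- k.

Definition a2_seq (k : nat) : rat := 3.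

Local Close Scope ring_scope.

(** Programs for the two sequences, uniformly in [P] and [n]. [clock P] executes
    [P] on the registers [7, 8, ...] until it finishes or the fuel in register
    [0] is used up, and counts the executed steps in register [1]. *)
Definition transfer x y : program := [:: While x [:: Dec x; Inc y]].

(** Runs [b] once if register [x] is nonzero and skips it otherwise. *)
Definition gate x y (b : program) : program :=
  While x (b ++ transfer x y) :: transfer y x.

Definition clocked (b : program) : program := gate 0 4 (Dec 0 :: Inc 1 :: b).
Definition test r : program := clocked (gate (7 + r) 6 [:: Inc 5]).

Fixpoint clock_cmd (c : cmd) : program :=
  match c with
  | Inc r => clocked [:: Inc (7 + r)]
  | Dec r => clocked [:: Dec (7 + r)]
  | While r b =>
      test r ++ [:: While 5 (Dec 5 :: flatten (map clock_cmd b) ++ test r)]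
  end.
Definition clock (p : program) : program := flatten (map clock_cmd p).

(** Turns [t] in register [1] into the output [3 + 2^-t]. *)
Definition output_prog : program :=
  [:: While 0 [:: Dec 0];
      While 1 ([:: Dec 1; While 2 [:: Dec 2; Inc 3; Inc 3]; Inc 3]
               ++ transfer 3 2);
      While 2 [:: Dec 2; Inc 3; Inc 0; Inc 0; Inc 0]]
  ++ transfer 3 2 ++ nseq 4 (Inc 0).

Definition a1_prog (P : program) (n : nat) : program :=
  nseq n (Inc 7) ++ clock P ++ output_prog.

Definition a2_prog : program := While 0 [:: Dec 0] :: nseq 3 (Inc 0).

Definition runs (p : program) (s s' : store) : Prop :=
  forall q, exists t, iter t step (p ++ q, s) = (q, s').

Lemma runs_cat p1 p2 s1 s2 s3 :
  runs p1 s1 s2 -> runs p2 s2 s3 -> runs (p1 ++ p2) s1 s3.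
Proof.
move=> h1 h2 q; have [t1 e1] := h1 (p2 ++ q); have [t2 e2] := h2 q.
by exists (t2 + t1); rewrite iterD -catA e1 e2.
Qed.

Lemma runs_cons c p s1 s2 s3 :
  runs [:: c] s1 s2 -> runs p s2 s3 -> runs (c :: p) s1 s3.
Proof. by move=> h1 h2; rewrite -cat1s; exact: runs_cat h1 h2. Qed.

Lemma runs_nil s : runs [::] s s.
Proof. by move=> q; exists 0. Qed.

Lemma runs_eq p s s1 s2 : s1 =1 s2 -> runs p s s1 -> runs p s s2.
Proof. by move=> /funext ->. Qed.

Lemma runs_inc r s : runs [:: Inc r] s (upd s r (s r).+1).
Proof. by move=> q; exists 1. Qed.

Lemma runs_dec r s : runs [:: Dec r] s (upd s r (s r).-1).
Proof. by move=> q; exists 1. Qed.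

Lemma runs_while0 r b s : s r = 0 -> runs [:: While r b] s s.
Proof. by move=> s0 q; exists 1; rewrite /= s0. Qed.

Lemma runs_whileS r b s s' : s r <> 0 ->
  runs (b ++ [:: While r b]) s s' -> runs [:: While r b] s s'.
Proof.
move=> /eqP/negbTE s0 h q; have [t e] := h q; exists t.+1.
by rewrite iterSr /= s0 -e -catA.
Qed.

Lemma runs_transfer x y s : x != y ->
  runs (transfer x y) s (upd (upd s y (s x + s y)) x 0).
Proof.
move=> xy; have [m] := ubnP (s x); elim: m s => // m IH s lem.
have [s0|/eqP s0] := eqVneq (s x) 0.
  apply: (runs_eq _ (runs_while0 _ s0)) => z; rewrite /upd.
  by case: eqP => [->//|_]; case: eqP => [->|//]; rewrite s0.
apply: runs_whileS => //.
apply: runs_cons; first exact: runs_dec.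
apply: runs_cons; first exact: runs_inc.
have yx : (y == x) = false by rewrite eq_sym (negbTE xy).
apply: (runs_eq _ (IH _ _)).
- move=> z; rewrite /upd !eqxx (negbTE xy) yx.
  by case: eqP => // _; case: eqP => // _; lia.
- by rewrite /upd eqxx (negbTE xy); lia.
Qed.

Lemma runs_gate0 x y b s : s x = 0 -> s y = 0 -> runs (gate x y b) s s.
Proof. by move=> sx sy; apply: runs_cons; apply: runs_while0. Qed.

Lemma runs_gate x y b s s' : x != y -> s x <> 0 -> s' y = 0 ->
  runs b s s' -> runs (gate x y b) s s'.
Proof.
move=> xy sx sy h.
have yx : (y == x) = false by rewrite eq_sym (negbTE xy).
apply: runs_cons.
  apply: runs_whileS => //; rewrite -catA; apply: runs_cat h _.
  apply: runs_cat; first exact: runs_transfer.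
  by apply: runs_while0; rewrite /upd eqxx.
apply: (runs_eq _ (runs_transfer _ _)); last by rewrite yx.
move=> z; rewrite /upd !eqxx yx sy.
by case: eqP => [->//|_]; case: eqP => [->|//]; lia.
Qed.

(** A store with given contents of the auxiliary registers [0], ..., [6]. *)
Definition st (F T D E Y Z X : nat) (s : store) : store := fun x =>
  match x with
  | 0 => F | 1 => T | 2 => D | 3 => E | 4 => Y | 5 => Z | 6 => X
  | x'.+4.+3 => s x'
  end.

Lemma upd_st F T D E Y Z X s r v :
  upd (st F T D E Y Z X s) (7 + r) v = st F T D E Y Z X (upd s r v).
Proof. by apply: funext; do 7 case=> //. Qed.

Lemma st_up F T D E Y Z X s r : st F T D E Y Z X s (7 + r) = s r.
Proof. by []. Qed.

Lemma runs_clocked b F T s s' Z :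
  runs b (st F T.+1 0 0 0 0 0 s) (st F T.+1 0 0 0 Z 0 s') ->
  runs (clocked b) (st F.+1 T 0 0 0 0 0 s) (st F T.+1 0 0 0 Z 0 s').
Proof.
move=> h; apply: runs_gate => //.
apply: runs_cons; first exact: runs_dec.
apply: runs_cons; first exact: runs_inc.
set s0 := upd _ _ _; suff -> : s0 = st F T.+1 0 0 0 0 0 s by [].
by apply: funext; do 7 case=> //.
Qed.

Lemma runs_test F T r s :
  runs (test r) (st F.+1 T 0 0 0 0 0 s) (st F T.+1 0 0 0 (s r != 0) 0 s).
Proof.
apply: runs_clocked; have [s0|s0] := eqVneq (s r) 0.
  exact: runs_gate0.
apply: runs_gate => //; first exact/eqP.
by apply: (runs_eq _ (runs_inc _ _)); do 7 case=> //.
Qed.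

Lemma runs_test0 T r s :
  runs (test r) (st 0 T 0 0 0 0 0 s) (st 0 T 0 0 0 0 0 s).
Proof. exact: runs_gate0. Qed.

Lemma runs_clock0 T s p :
  runs (clock p) (st 0 T 0 0 0 0 0 s) (st 0 T 0 0 0 0 0 s).
Proof.
elim: p => [|c p IH]; first exact: runs_nil.
apply: runs_cat IH; case: c => [r|r|r b]; try exact: runs_gate0.
by apply: runs_cat; [exact: runs_test0 | exact: runs_while0].
Qed.

Fixpoint used (k : nat) (c : config) : nat :=
  if k is k'.+1 then if nilp c.1 then 0 else (used k' (step c)).+1 else 0.

Lemma clock_cat p q : clock (p ++ q) = clock p ++ clock q.
Proof. by rewrite /clock map_cat flatten_cat. Qed.

Lemma runs_clock F p s T : exists F' s',
  runs (clock p) (st F T 0 0 0 0 0 s)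
       (st F' (used F (p, s) + T) 0 0 0 0 0 s').
Proof.
elim: F p s T => [|F IH] p s T.
  by exists 0, s; exact: runs_clock0.
case: p => [|c p]; first by exists F.+1, s; exact: runs_nil.
have key b : runs (clock_cmd c) (st F.+1 T 0 0 0 0 0 s)
                  (st F T.+1 0 0 0 0 0 b) -> step (c :: p, s) = (p, b) ->
   exists F' s', runs (clock (c :: p)) (st F.+1 T 0 0 0 0 0 s)
       (st F' (used F.+1 (c :: p, s) + T) 0 0 0 0 0 s').
  move=> h e; have [F' [s' h']] := IH p b T.+1.
  exists F', s'; apply: runs_cat h _.
  by rewrite [used _ _]/= -/(step (c :: p, s)) e addSnnS.
case: c key => [r|r|r b] key.
- apply: (key (upd s r (s r).+1)) => //; apply: runs_clocked.
  by rewrite -upd_st; exact: runs_inc.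
- apply: (key (upd s r (s r).-1)) => //; apply: runs_clocked.
  by rewrite -upd_st; exact: runs_dec.
have [s0|s0] := eqVneq (s r) 0.
  apply: (key s); last by rewrite /= s0.
  apply: runs_cat; first exact: runs_test.
  by rewrite s0; exact: runs_while0.
have [F' [s' h']] := IH (b ++ While r b :: p) s T.+1.
exists F', s'.
rewrite [used _ _]/= (negbTE s0) addSnnS.
have -> : clock (While r b :: p)
    = test r ++ While 5 (Dec 5 :: clock b ++ test r) :: clock p by [].
apply: runs_cat; first exact: runs_test.
rewrite s0 => q; have [t e] := h' q; exists t.+2; rewrite 2!iterSr -e.
have -> : clock (b ++ While r b :: p)
    = clock b ++ test r ++ While 5 (Dec 5 :: clock b ++ test r) :: clock p.
  by rewrite clock_cat.
rewrite -[_ :: clock p]cat1s /= -!catA; congr (iter _ _ (_, _)).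
by apply: funext; do 7 case=> //.
Qed.

Lemma used_run p n k : finished p n k ->
  used k (p, init n) = finish_step p n k.
Proof.
rewrite /finish_step /finished /run; elim: k (p, init n) => [|k IH] c.
  by move=> /= ->.
rewrite iterSr => /IH {}IH.
have -> : iota 0 k.+2 = 0 :: map S (iota 0 k.+1) by rewrite -(iotaDl 1 0).
rewrite [RHS]/= -/(iota 0 k.+1) find_map /= IH; case: ifP => // _.
by congr _.+1; apply: eq_find => x /=; rewrite -iterS iterSr.
Qed.

Lemma used_unfinished p n k : ~~ finished p n k -> used k (p, init n) = k.
Proof.
rewrite /finished /run; elim: k (p, init n) => [|k IH] c //=.
case: ifP => [nc|_]; last by rewrite -iterS iterSr => /IH ->.
suff -> : iter k step c = c by case: c nc => [[|]].
by elim: k {IH} => //= k ->; case: c nc => [[|]].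
Qed.

Lemma runs_clear s : runs [:: While 0 [:: Dec 0]] s (upd s 0 0).
Proof.
have [m] := ubnP (s 0); elim: m s => // m IH s lem.
have [s0|/eqP s0] := eqVneq (s 0) 0.
  by apply: (runs_eq _ (runs_while0 _ s0)) => -[|z].
apply: runs_whileS => //; apply: runs_cons; first exact: runs_dec.
by apply: (runs_eq _ (IH _ _)) => [[|z]//|]; rewrite /upd /=; lia.
Qed.

Lemma runs_double F T D E Y Z X s :
  runs [:: While 2 [:: Dec 2; Inc 3; Inc 3]] (st F T D E Y Z X s)
       (st F T 0 (D.*2 + E) Y Z X s).
Proof.
elim: D E => [|D IH] E; first exact: runs_while0.
apply: runs_whileS => //; apply: runs_cons; first exact: runs_dec.
apply: runs_cons; first exact: runs_inc.
apply: runs_cons; first exact: runs_inc.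
rewrite doubleS !addSn -!addnS; set s0 := upd _ _ _.
suff -> : s0 = st F T D E.+2 Y Z X s by exact: IH.
by apply: funext; do 7 case=> //.
Qed.

Lemma runs_triple F T D E Y Z X s :
  runs [:: While 2 [:: Dec 2; Inc 3; Inc 0; Inc 0; Inc 0]]
       (st F T D E Y Z X s) (st (3 * D + F) T 0 (D + E) Y Z X s).
Proof.
elim: D E F => [|D IH] E F; first exact: runs_while0.
apply: runs_whileS => //; apply: runs_cons; first exact: runs_dec.
do 4 (apply: runs_cons; first exact: runs_inc).
set s0 := upd _ _ _.
have -> : s0 = st F.+3 T D E.+1 Y Z X s by apply: funext; do 7 case=> //.
by apply: (runs_eq _ (IH _ _)); do 7 (case; [by rewrite /=; lia|]).
Qed.

Lemma runs_transfer32 F T D E Y Z X s :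
  runs (transfer 3 2) (st F T D E Y Z X s) (st F T (E + D) 0 Y Z X s).
Proof. by apply: (runs_eq _ (runs_transfer _ _)) => //; do 7 case=> //. Qed.

Lemma runs_power F T D Y Z X s :
  runs [:: While 1 ([:: Dec 1; While 2 [:: Dec 2; Inc 3; Inc 3]; Inc 3]
               ++ transfer 3 2)] (st F T D 0 Y Z X s)
       (st F 0 (2 ^ T * D.+1).-1 0 Y Z X s).
Proof.
elim: T D => [|T IH] D.
  by rewrite mul1n; exact: runs_while0.
apply: runs_whileS => //; rewrite -catA.
apply: runs_cat; last first.
  apply: runs_cat; first exact: (@runs_transfer32 F T 0 D.*2.+1 Y Z X).
  rewrite addn0; apply: (runs_eq _ (IH _)).
  by rewrite -doubleS expnSr -mulnA mul2n.
apply: runs_cons; first exact: runs_dec.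
apply: (runs_cons (s2 := st F T 0 D.*2 Y Z X s)).
  rewrite -[D.*2]addn0; set s0 := upd _ _ _.
  suff -> : s0 = st F T D 0 Y Z X s by exact: runs_double.
  by apply: funext; do 7 case=> //.
by apply: (runs_eq _ (runs_inc _ _)); do 7 case=> //.
Qed.

Lemma runs_output F T s :
  runs output_prog (st F T 0 0 0 0 0 s)
       (st (3 * (2 ^ T).-1 + 4) 0 (2 ^ T).-1 0 0 0 0 s).
Proof.
apply: (runs_cons (s2 := st 0 T 0 0 0 0 0 s)).
  by apply: (runs_eq _ (runs_clear _)); do 7 case=> //.
apply: runs_cons; first exact: runs_power.
rewrite muln1; apply: runs_cons; first exact: runs_triple.
apply: runs_cat; first exact: runs_transfer32.
do 4 (apply: runs_cons; first exact: runs_inc).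
apply: (runs_eq _ (runs_nil _)).
by do 7 (case; [by rewrite /upd /=; lia|]).
Qed.

Lemma runs_input n F s :
  runs (nseq n (Inc 7)) (st F 0 0 0 0 0 0 s)
       (st F 0 0 0 0 0 0 (upd s 0 (n + s 0))).
Proof.
elim: n s => [|n IH] s.
  by apply: (runs_eq _ (runs_nil _)); do 7 (case; first by []); case.
apply: (runs_cons (runs_inc _ _)); rewrite -[7]/(7 + 0) upd_st st_up.
apply: (runs_eq _ (IH _)); do 7 (case; first by []); case=> //=.
by rewrite /upd /= addnS.
Qed.

Lemma runs_computes_rat p n s q :
  runs p (init n) s -> rat_of_store s = q -> computes_rat p n q.
Proof.
move=> h e; have [t] := h [::]; rewrite cats0 => ht.
by exists t; rewrite /finished /run ht.
Qed.

Lemma init_st k : init k = st k 0 0 0 0 0 0 (fun _ => 0).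
Proof. by apply: funext; do 7 case=> //. Qed.

Local Open Scope ring_scope.

Lemma a1_seqE P n k : a1_seq P n k = 3 + 2 ^- used k (P, init n).
Proof.
rewrite /a1_seq; case: ifPn => [/used_run ->|/used_unfinished ->] //.
Qed.

Lemma a1_progP P n k : computes_rat (a1_prog P n) k (a1_seq P n k).
Proof.
have [F' [s' h]] := runs_clock k P (init n) 0.
rewrite addn0 in h; rewrite a1_seqE.
apply: runs_computes_rat.
  apply: runs_cat; last by apply: runs_cat h _; exact: runs_output.
    rewrite init_st; apply: (runs_eq _ (runs_input n k _)) => x.
    by rewrite /init /= addn0.
set t := used _ _; rewrite /rat_of_store /=.
have t0 : (0 < 2 ^ t)%N by rewrite expn_gt0.
have -> : (3 * (2 ^ t).-1 + 4 = 3 * 2 ^ t + 1)%N by lia.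
rewrite prednK // natrD natrM natrX subr0 mulrDl mulfK ?mul1r //.
by rewrite expf_neq0.
Qed.

Lemma a2_progP k : computes_rat a2_prog k (a2_seq k).
Proof.
apply: runs_computes_rat.
  apply: runs_cons; first exact: runs_clear.
  by do 3 (apply: runs_cons; first exact: runs_inc); exact: runs_nil.
by rewrite /rat_of_store.
Qed.

Lemma id_progP n : computes [::] n n.
Proof. by exists 0%N. Qed.

Lemma used_ge P n i j : (i <= j)%N ->
  used i (P, init n) = used j (P, init n) \/
  (i <= used i (P, init n))%N /\ (i <= used j (P, init n))%N.
Proof.
elim: i j (P, init n) => [|i IH] [|j] c //= ij; try by right.
case: ifP => _; first by left.
by case: (IH j (step c) ij) => [->|h]; [left|right].
Qed.

Lemma a1_cauchy P n (m i j : nat) : (0 < m)%N -> (m <= i)%N -> (m <= j)%N ->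
  `|a1_seq P n i - a1_seq P n j| < 2 ^- m.
Proof.
move=> _; wlog ij : i j / (i <= j)%N.
  move=> h mi mj; case/orP: (leq_total i j) => ij; first exact: h.
  by rewrite distrC; exact: h.
move=> mi mj; rewrite !a1_seqE opprD addrACA subrr add0r.
have m0 k : 0 < 2 ^- k :> rat by rewrite invr_gt0 exprn_gt0.
have [->|[li lj]] := used_ge P n ij; first by rewrite subrr normr0.
have lem k : (i <= k)%N -> 2 ^- k <= 2 ^- m :> rat.
  move=> ik; rewrite lef_pV2 ?posrE ?exprn_gt0 // ler_eXn2l //.
  exact: leq_trans ik.
have := lem _ li; have := lem _ lj; have := m0 (used i (P, init n)).
have := m0 (used j (P, init n)); rewrite ltr_norml.
by move=> *; apply/andP; split; lra.
Qed.

Lemma a2_cauchy (m i j : nat) : (0 < m)%N -> (m <= i)%N -> (m <= j)%N ->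
  `|a2_seq i - a2_seq j| < 2 ^- m.
Proof. by move=> _ _ _; rewrite subrr normr0 invr_gt0 exprn_gt0. Qed.

(** The modulus of convergence is the identity, computed by the empty program. *)
Definition a1 (P : program) (n : nat) : crn :=
  Crn (a1_progP P n) id_progP (@a1_cauchy P n).

Definition a2 (n : nat) : crn := Crn a2_progP id_progP a2_cauchy.

(* Main.v *)
(** If [P] never finishes on [n], then [a_n^1] has value [3], so that AM = GM;
    if [P] finishes at step [m], the value is [3 + 2^-m] and AM > GM. A decision
    procedure [D] for AM = GM would therefore decide the halting of [P], and
    running [D] first, then [P] only if [D] announces that [P] halts, would be
    a total extension of [P]. *)
Require Import Defs.
From mathcomp Require Import all_boot all_order all_algebra reals.
From mathcomp Require Import zify ring lra.
From mathcomp Require Import boolp classical_sets topology normedtype sequences.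

Set Implicit Arguments.
Unset Strict Implicit.
Unset Printing Implicit Defensive.
Import Order.TTheory GRing.Theory Num.Theory.
Import numFieldNormedType.Exports.

(** * Simulation on renamed registers *)

Fixpoint rename_cmd (f : nat -> nat) (c : cmd) : cmd :=
  match c with
  | Inc r => Inc (f r)
  | Dec r => Dec (f r)
  | While r b => While (f r) (map (rename_cmd f) b)
  end.
Definition rename (f : nat -> nat) (p : program) : program :=
  map (rename_cmd f) p.

(* [e s] is a store holding the contents of [s] in the registers [f r]. *)
Lemma runs_rename (f : nat -> nat) (e : store -> store) :
  (forall s r, e s (f r) = s r) ->
  (forall s r v, upd (e s) (f r) v = e (upd s r v)) ->
  forall k p s s', iter k step (p, s) = ([::], s') ->
  runs (rename f p) (e s) (e s').
Proof.
move=> ef eu; elim=> [|k IH] p s s'.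
  by move=> [-> ->]; exact: runs_nil.
rewrite iterSr; case: p => [|[r|r|r b] p] /= h.
- exact: IH h.
- by apply: runs_cons (IH _ _ _ h); rewrite -eu -(ef s r); exact: runs_inc.
- by apply: runs_cons (IH _ _ _ h); rewrite -eu -(ef s r); exact: runs_dec.
case: eqP h => [s0|/eqP/negbTE s0] /IH h.
  by apply: runs_cons h; apply: runs_while0; rewrite ef.
move=> q; have [t et] := h q; exists t.+1.
by rewrite iterSr /= ef s0 -et /rename map_cat /= -catA.
Qed.

Lemma runs_computes p n s y : runs p (init n) s -> s 0 = y -> computes p n y.
Proof.
move=> h e; have [t] := h [::]; rewrite cats0 => ht.
by exists t; rewrite /finished /run ht.
Qed.

Lemma computes_iter p n y : computes p n y ->
  exists k s, iter k step (p, init n) = ([::], s) /\ s 0 = y.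
Proof.
case=> k []; rewrite /finished /run.
by case E: (iter k step _) => [[|//] s] _ e; exists k, s.
Qed.

(** Interleaving lets two programs share one machine without disturbing each other, and keeps
    register [0] free for input and output. *)
Definition pack (z : nat) (u v : store) : store := fun x =>
  if x is x'.+1 then if odd x' then v x'./2 else u x'./2 else z.

Definition oddreg r := r.*2.+1.
Definition evenreg r := r.*2.+2.

Lemma pack_odd z u v r : pack z u v (oddreg r) = u r.
Proof. by rewrite /= odd_double doubleK. Qed.

Lemma pack_even z u v r : pack z u v (evenreg r) = v r.
Proof. by rewrite /= odd_double uphalf_double. Qed.

Lemma upd_pack_odd z u v r w :
  upd (pack z u v) (oddreg r) w = pack z (upd u r w) v.
Proof.
apply: funext => -[|x] //; rewrite /upd /pack /oddreg eqSS.
have [-> | xr] := eqVneq x r.*2; first by rewrite odd_double doubleK eqxx.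
case: ifPn => // ox; case: eqP => // e; case/eqP: xr.
by rewrite -e even_halfK.
Qed.

Lemma upd_pack_even z u v r w :
  upd (pack z u v) (evenreg r) w = pack z u (upd v r w).
Proof.
apply: funext => -[|x] //; rewrite /upd /pack /evenreg eqSS.
have [-> | xr] := eqVneq x r.*2.+1.
  by rewrite /= odd_double uphalf_double eqxx.
case: ifPn => // ox; case: eqP => // e; case/eqP: xr.
by rewrite -e odd_halfK //; case: x ox {e}.
Qed.

Lemma runs_odd k p z u u' v : iter k step (p, u) = ([::], u') ->
  runs (rename oddreg p) (pack z u v) (pack z u' v).
Proof.
apply: (runs_rename (e := fun u => pack z u v)) => *.
  exact: pack_odd.
exact: upd_pack_odd.
Qed.

Lemma runs_even k p z u v v' : iter k step (p, v) = ([::], v') ->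
  runs (rename evenreg p) (pack z u v) (pack z u v').
Proof.
apply: (runs_rename (e := pack z u)) => *.
  exact: pack_even.
exact: upd_pack_even.
Qed.

Definition clear r : program := [:: While r [:: Dec r]].

Lemma runs_clear r s : runs (clear r) s (upd s r 0).
Proof.
have [m] := ubnP (s r); elim: m s => // m IH s lem.
have [s0|/eqP s0] := eqVneq (s r) 0%N.
  by apply: (runs_eq _ (runs_while0 _ s0)) => z; rewrite /upd; case: eqP => // ->.
apply: runs_whileS => //; apply: runs_cons; first exact: runs_dec.
apply: (runs_eq _ (IH _ _)) => [z|]; rewrite /upd ?eqxx; last by lia.
by case: eqP.
Qed.

(** * Running [P] under the control of [D] *)

Definition split_input : program := [:: While 0 [:: Dec 0; Inc 1; Inc 2]].

Lemma runs_split_input n : runs split_input (init n) (pack 0 (init n) (init n)).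
Proof.
(* Loop invariant: [n] is what remains in register [0], and [m] is what both copies have received so
   far. *)
have key m : runs split_input (pack n (init m) (init m))
                  (pack 0 (init (n + m)) (init (n + m))).
  elim: n m => [|n IH] m; first exact: runs_while0.
  apply: runs_whileS => //.
  apply: runs_cons; first exact: runs_dec.
  do 2 (apply: runs_cons; first exact: runs_inc).
  set s := upd _ _ _; rewrite addSnnS.
  have -> : s = pack n (init m.+1) (init m.+1); last exact: IH.
  apply: funext; by do 3 case=> //.
have init_pack : init n = pack n (init 0) (init 0).
  apply: funext => -[|x] //=; rewrite /init /upd /=.
  by case: ifP; case: eqP.
by rewrite {1}init_pack -{2 3}[n]addn0.
Qed.

(** Runs [D] on the odd registers and, if its output is nonzero, runs [P] on
    the positive even registers; register [0] keeps the default output [0]. *)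
Definition guarded (D P : program) : program :=
  split_input ++ rename oddreg D ++
  [:: While 1 (rename evenreg P ++ transfer 2 0 ++ clear 1)].

(** The answer of [D] lies in register [1], which is [oddreg 0], so the loop is skipped and [P],
    which may diverge on [n], is never started. *)
Lemma guarded0 D P n : computes D n 0 -> computes (guarded D P) n 0.
Proof.
move=> /computes_iter[k [u [hD u0]]].
apply: runs_computes (pack 0 u (init n)) _ _ _ => //.
apply: runs_cat (runs_split_input n) _; apply: runs_cat (runs_odd _ _ hD) _.
exact: runs_while0.
Qed.

Lemma guardedS D P n m y : computes D n m.+1 -> computes P n y ->
  computes (guarded D P) n y.
Proof.
move=> /computes_iter[k [u [hD u0]]] /computes_iter[l [v [hP v0]]].
apply: runs_computes.
  apply: runs_cat (runs_split_input n) _; apply: runs_cat (runs_odd _ _ hD) _.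
  apply: runs_whileS; first by rewrite /= u0.
  rewrite -!catA; apply: runs_cat; first exact: runs_even hP.
  (* [P] left its output in register [2], which is [evenreg 0]. Register [0] was emptied by
     [split_input], so it receives exactly this output; clearing register [1] then ends the loop
     after one pass. *)
  apply: runs_cat; first exact: runs_transfer.
  apply: runs_cat; first exact: runs_clear.
  exact: runs_while0.
by rewrite /upd /= v0 addn0.
Qed.

(** * Values of the constructive reals *)

Lemma used_finished P n K k : finished P n K -> (K <= k)%N ->
  used k (P, init n) = used K (P, init n).
Proof.
rewrite /finished /run; elim: K k (P, init n) => [|K IH] [|k] c //=.
  by move=> ->.
by rewrite -iterS iterSr ltnS => h Kk; rewrite (IH k).
Qed.

Local Open Scope ring_scope.

Local Open Scope classical_set_scope.

Lemma crn_val_a2 (R : realType) n : crn_val R (a2 n) = 3.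
Proof. by rewrite /crn_val /= /a2_seq ratr_nat; exact: lim_cst. Qed.

Lemma ratr_a1 (R : realType) P n k :
  ratr (a1_seq P n k) = 3 + 2 ^- used k (P, init n) :> R.
Proof. by rewrite a1_seqE rmorphD /= fmorphV /= rmorphXn /= !ratr_nat. Qed.

Lemma crn_val_a1_unfinished (R : realType) P n : (forall k, ~~ finished P n k) ->
  crn_val R (a1 P n) = 3.
Proof.
move=> nf; rewrite /crn_val /=; apply: cvg_lim => //.
(* As [P] never halts, all the fuel is used and the sequence is $3$ plus a geometric sequence of
   ratio $1/2$. *)
rewrite -[X in _ --> X]addr0.
have -> : (fun k => ratr (a1_seq P n k)) = (fun k => 3 + 2^-1 ^+ k) :> (nat -> R).
  by apply: funext => k; rewrite ratr_a1 used_unfinished // exprVn.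
apply: cvgD; first exact: cvg_cst.
by apply: cvg_expr; rewrite ger0_norm; lra.
Qed.

Lemma crn_val_a1_finished (R : realType) P n K : finished P n K ->
  crn_val R (a1 P n) = 3 + 2 ^- used K (P, init n).
Proof.
move=> fK; rewrite /crn_val /=; apply: cvg_lim => //.
(* The sequence is constant from index [K] on. *)
apply: cvg_near_cst; near=> k.
rewrite ratr_a1 (used_finished fK) //.
by near: k; exact: nbhs_infty_ge.
Unshelve. all: by end_near. Qed.

Local Close Scope classical_set_scope.

(** * Equality of the means and undecidability *)

Lemma AM_eq_GM (R : rcfType) (x y : R) : 0 <= x -> 0 <= y ->
  (x + y) / 2 = Num.sqrt (x * y) -> x = y.
Proof.
move=> x0 y0 /(congr1 (fun z => z ^+ 2)); rewrite sqr_sqrtr ?mulr_ge0 // => e.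
apply/eqP; rewrite -subr_eq0 -sqrf_eq0; apply/eqP.
have -> : (x - y) ^+ 2 = (((x + y) / 2) ^+ 2 - x * y) * 4 by field.
by rewrite e subrr mul0r.
Qed.

Theorem theorem3 (R : realType) (P : program)
    (P01 : binary_valued P) (Pnonext : ~ extendable P) :
  let AM (n : nat) : R := (crn_val R (a1 P n) + crn_val R (a2 n)) / 2 in
  let GM (n : nat) : R := Num.sqrt (crn_val R (a1 P n) * crn_val R (a2 n)) in
  ~ exists D : program, forall n : nat,
      (computes D n 0 /\ AM n = GM n) \/ (computes D n 1 /\ AM n > GM n).
Proof.
move=> AM GM [D hD]; apply: Pnonext; exists (guarded D P).
(* The answer [1] forces halting: otherwise both numbers are $3$ and the strict inequality fails. *)
have halts n : computes D n 0 \/ computes D n 1 /\ exists k, finished P n k.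
  case: (hD n) => -[Dn amgm]; [by left | right; split=> //].
  apply: contrapT => /forallNP nf; move: amgm.
  rewrite /AM /GM crn_val_a2 crn_val_a1_unfinished.
    by rewrite -expr2 sqrtr_sqr ger0_norm; lra.
  by move=> k; apply/negP/nf.
(* Conversely, halting excludes the answer [0]: equal means would force $3 + 2^{-t} = 3$, where $t$
   is the number of steps used. *)
have D1 n y : computes P n y -> computes D n 1.
  case=> K [fK _]; case: (hD n) => -[Dn amgm] //.
  have p0 : 0 < 2 ^- used K (P, init n) :> R by rewrite invr_gt0 exprn_gt0.
  move: amgm; rewrite /AM /GM crn_val_a2 (crn_val_a1_finished R fK).
  by move/AM_eq_GM; lra.
split=> [n|n y Pn]; last exact: guardedS (D1 n y Pn) Pn.
case: (halts n) => [D0|[Dn [k fk]]].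
  by exists false; exact: guarded0.
have Pn : computes P n ((run P n k).2 0%N) by exists k.
(* Totality asks for a boolean output; [P01] supplies it. *)
by have := guardedS Dn Pn; case: (P01 _ _ Pn) => ->; [exists false|exists true].
Qed.
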